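(* For $R>0$ let $\delta_R:\mathbb{R}\to\mathbb{R}$ be given by $\delta_R(x):=\frac{1}{2\pi}\int_{-R}^{R}e^{ikx}\,dk$, that is, $\delta_R(x)=\frac{\sin(Rx)}{\pi x}$ for $x\neq 0$ and $\delta_R(0)=\frac{R}{\pi}$. Then for every test function $f\in\mathcal{D}$, $$\lim_{R\to\infty}\delta_R[f]=f(0),\qquad\text{where}\quad \delta_R[f]:=\int_{-\infty}^{\infty}\delta_R(x)f(x)\,dx .$$
   Context: $\mathcal{D}:=C_0^\infty(\mathbb{R})$ is the vector space of smooth (infinitely differentiable) complex-valued functions on $\mathbb{R}$ with compact support; its elements are called test functions. *)

(* Defs.v *)
From Stdlib Require Export Reals Rtopology.
From Coquelicot Require Export Coquelicot.
Open Scope R_scope.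

(* The carrier [C] canonically carries its normed-module structure over itself.
   Calculus of functions R -> C needs the one over R, which is therefore always
   passed explicitly, as [C_R_NormedModule] or [C_R_CompleteNormedModule]. *)

Fixpoint differentiable_times (n : nat) (f : R -> C) : Prop :=
  match n with
  | O => True
  | S m => exists g : R -> C,
      (forall x : R, is_derive (V := C_R_NormedModule) f x (g x)) /\
      differentiable_times m g
  end.

Definition smooth (f : R -> C) : Prop :=
  forall n : nat, differentiable_times n f.

Definition support (f : R -> C) : R -> Prop :=
  adherence (fun x : R => f x <> RtoC 0).

Definition test_function (f : R -> C) : Prop :=
  smooth f /\ compact (support f).

Definition Cexp (z : C) : C :=
  Cmult (RtoC (exp (Re z))) (cos (Im z), sin (Im z)).

(* [delta r] is C-valued, being an integral of complex exponentials; for r > 0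
   its values are real (the integral of the imaginary part vanishes). *)
Definition delta (r x : R) : C :=
  Cmult (RtoC (/ (2 * PI)))
    (RInt (V := C_R_CompleteNormedModule)
       (fun k : R => Cexp (Cmult Ci (RtoC (k * x)))) (- r) r).

(* The two limits of integration tend to -oo and +oo independently. *)
Definition delta_pairing (r : R) (f : R -> C) : C :=
  RInt_gen (V := C_R_CompleteNormedModule)
    (fun x : R => Cmult (delta r x) (f x))
    (Rbar_locally m_infty) (Rbar_locally p_infty).

(* Main.v *)
Require Import Defs.
From Stdlib Require Import Lra.

(** With [sinc y = sin y / y], the kernel is [delta r x = r / PI * sinc (r * x)].
    Write
      [J y] = integral over [0, PI / 2] of [exp (- y sin t) cos (y cos t) dt].
    Cauchy's theorem for [exp (i y z) / z] on a quarter disc suggests that [J] is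
    the tail of the sine integral, from [y] to infinity.  This is proved without
    contours or improper integrals: differentiating under the integral sign
    leaves an integrand with an elementary primitive in [t], so that [J' = - sinc]
    ([is_derive_sinc_tail]); clearly [J 0 = PI / 2]; and the factor
    [exp (- y sin t)] forces [|J y| <= 5 / (1 + y)] for [y >= 0]
    ([sinc_tail_bound]).

    If [h] is C^1 and vanishes at [A], then integrating by parts with the
    primitive [- J (r x)] of [r sinc (r x)] gives
      integral over [0, A] of [r sinc (r x) h x]
        = [PI / 2 * h 0] + integral over [0, A] of [J (r x) h' x],
    and the last term is at most a constant times [ln (1 + r A) / r], which tends
    to zero.  The integral of the even kernel against [f] over [- A, A] is the one
    over [0, A] against [h x = f x + f (- x)], for which [h 0 = 2 * f 0]; dividing
    by [PI] yields the limit [f 0] ([sinc_kernel_limit]).  A test function is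
    handled through its real and imaginary parts, with [A] chosen beyond its
    support, so that the improper integral is one over [- A, A]. *)

(** * The sinc function *)

Definition sinc (y : R) : R := if Req_EM_T y 0 then 1 else sin y / y.

Lemma sinc_mult_self (y : R) : y * sinc y = sin y.
Proof.
  unfold sinc; destruct (Req_EM_T y 0) as [-> | Hy].
  - rewrite sin_0; ring.
  - field; exact Hy.
Qed.

Lemma sinc_even (y : R) : sinc (- y) = sinc y.
Proof.
  unfold sinc; destruct (Req_EM_T (- y) 0), (Req_EM_T y 0); try lra.
  rewrite sin_neg; field; assumption.
Qed.

Lemma continuous_sinc (y : R) : continuous sinc y.
Proof.
  destruct (Req_dec y 0) as [-> | Hy].
  - apply continuity_pt_filterlim, continuity_pt_filterlim'.
    replace (sinc 0) with 1 by (unfold sinc; destruct (Req_EM_T 0 0); lra).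
    apply (is_lim_ext_loc (fun x => sin x / x) sinc 0 1).
    + exists (mkposreal 1 Rlt_0_1); intros x _ Hx.
      unfold sinc; destruct (Req_EM_T x 0); [contradiction | reflexivity].
    + apply is_lim_sinc_0.
  - apply continuous_ext_loc with (fun x => sin x / x).
    + assert (Hp : 0 < Rabs y) by now apply Rabs_pos_lt.
      exists (mkposreal _ Hp); intros x Hx.
      unfold sinc; destruct (Req_EM_T x 0) as [-> | ]; [ | reflexivity].
      change (Rabs (0 - y) < Rabs y) in Hx.
      rewrite Rminus_0_l, Rabs_Ropp in Hx; lra.
    + apply (ex_derive_continuous (fun x => sin x / x)); auto_derive; exact Hy.
Qed.

(** * The tail of the sine integral *)

(** The real part of [exp (i y z)] at the point [z = exp (i t)] of the unit
    circle. *)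
Definition quarter_arc (y t : R) : R := exp (- (y * sin t)) * cos (y * cos t).

(** Equal to the integral of [sinc] from [y] to infinity; this form avoids the
    improper integral, and the properties below are all that is used of it. *)
Definition sinc_tail (y : R) : R := RInt (quarter_arc y) 0 (PI / 2).

Lemma continuous_quarter_arc (y t : R) : continuous (quarter_arc y) t.
Proof.
  apply (ex_derive_continuous (quarter_arc y)).
  unfold quarter_arc; auto_derive; auto.
Qed.

Lemma ex_RInt_quarter_arc (y a b : R) : ex_RInt (quarter_arc y) a b.
Proof.
  apply (ex_RInt_continuous (quarter_arc y)).
  intros; apply continuous_quarter_arc.
Qed.

Definition quarter_arc_deriv (y t : R) : R :=
  - (exp (- (y * sin t)) * (sin t * cos (y * cos t) + cos t * sin (y * cos t))).

Lemma is_derive_quarter_arc (y t : R) :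
  is_derive (fun z => quarter_arc z t) y (quarter_arc_deriv y t).
Proof.
  unfold quarter_arc, quarter_arc_deriv; auto_derive; [auto | ring].
Qed.

(** For [y <> 0] a primitive in [t] is [exp (- y sin t) sin (y cos t) / y], which
    vanishes at [PI / 2] and equals [sin y / y] at [0].  For [y = 0] the integrand
    is [- sin t]. *)
Lemma RInt_quarter_arc_deriv (y : R) :
  RInt (quarter_arc_deriv y) 0 (PI / 2) = - sinc y.
Proof.
  destruct (Req_dec y 0) as [-> | Hy].
  - replace (- sinc 0) with (minus (cos (PI / 2)) (cos 0)).
    2: { unfold sinc; destruct (Req_EM_T 0 0); [ | lra].
         rewrite cos_PI2, cos_0; unfold minus, plus, opp; simpl; ring. }
    apply is_RInt_unique, (is_RInt_ext (fun t => - sin t)).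
    { intros t _; unfold quarter_arc_deriv.
      rewrite !Rmult_0_l, Ropp_0, exp_0, cos_0, sin_0; simpl; ring. }
    apply (is_RInt_derive cos); intros t _.
    + auto_derive; [auto | ring].
    + apply (ex_derive_continuous (fun t => - sin t)); auto_derive; auto.
  - set (F := fun t => exp (- (y * sin t)) * sin (y * cos t) / y).
    replace (- sinc y) with (minus (F (PI / 2)) (F 0)).
    2: { unfold F, sinc; destruct (Req_EM_T y 0); [contradiction | ].
         rewrite cos_PI2, cos_0, sin_0, !Rmult_0_r, sin_0, Ropp_0, exp_0.
         rewrite Rmult_1_r; unfold minus, plus, opp; simpl; field; exact Hy. }
    apply is_RInt_unique, (is_RInt_derive F); intros t _.
    + unfold F, quarter_arc_deriv; auto_derive; [auto | field; exact Hy].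
    + apply (ex_derive_continuous (quarter_arc_deriv y)).
      unfold quarter_arc_deriv; auto_derive; auto.
Qed.

Lemma continuity_2d_quarter_arc_deriv (y t : R) :
  continuity_2d_pt quarter_arc_deriv y t.
Proof.
  assert (Hs : forall g : R -> R -> R, continuity_2d_pt g y t ->
            continuity_2d_pt (fun u v => sin (g u v)) y t).
  { intros g; apply continuity_1d_2d_pt_comp, continuity_sin. }
  assert (Hc : forall g : R -> R -> R, continuity_2d_pt g y t ->
            continuity_2d_pt (fun u v => cos (g u v)) y t).
  { intros g; apply continuity_1d_2d_pt_comp, continuity_cos. }
  assert (He : forall g : R -> R -> R, continuity_2d_pt g y t ->
            continuity_2d_pt (fun u v => exp (g u v)) y t).
  { intros g; apply continuity_1d_2d_pt_comp.
    apply derivable_continuous_pt, derivable_pt_exp. }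
  unfold quarter_arc_deriv.
  repeat first
    [ apply continuity_2d_pt_id1 | apply continuity_2d_pt_id2
    | apply continuity_2d_pt_opp | apply continuity_2d_pt_plus
    | apply continuity_2d_pt_mult | apply He | apply Hs | apply Hc ].
Qed.

Lemma is_derive_sinc_tail (y : R) : is_derive sinc_tail y (- sinc y).
Proof.
  rewrite <- RInt_quarter_arc_deriv.
  assert (HD : forall u v, Derive (fun z => quarter_arc z v) u
                           = quarter_arc_deriv u v).
  { intros u v; apply is_derive_unique, is_derive_quarter_arc. }
  rewrite (RInt_ext (quarter_arc_deriv y)
             (fun t => Derive (fun z => quarter_arc z t) y)).
  2: { intros t _; symmetry; apply HD. }
  apply (is_derive_RInt_param quarter_arc 0 (PI / 2) y).
  - apply filter_forall; intros u t _.
    eexists; apply is_derive_quarter_arc.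
  - intros t _.
    apply (continuity_2d_pt_ext quarter_arc_deriv).
    + intros u v; symmetry; apply HD.
    + apply continuity_2d_quarter_arc_deriv.
  - apply filter_forall; intros u; apply ex_RInt_quarter_arc.
Qed.

Lemma continuous_sinc_tail (y : R) : continuous sinc_tail y.
Proof.
  apply (ex_derive_continuous sinc_tail).
  eexists; apply is_derive_sinc_tail.
Qed.

Lemma sinc_tail_0 : sinc_tail 0 = PI / 2.
Proof.
  unfold sinc_tail.
  rewrite (RInt_ext _ (fun _ => 1)).
  - rewrite RInt_const; unfold scal; simpl; unfold mult; simpl; ring.
  - intros t _; unfold quarter_arc.
    rewrite !Rmult_0_l, Ropp_0, exp_0, cos_0; simpl; ring.
Qed.

(** By the Taylor bound [sin t >= t - t^3 / 6]; the slope [1 / 3] is not the best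
    one, but it already follows from the crude estimate [PI <= 4]. *)
Lemma third_le_sin (t : R) : 0 <= t <= PI / 2 -> t / 3 <= sin t.
Proof.
  intros [Ht0 Ht1].
  pose proof PI_4 as HPI.
  destruct (pre_sin_bound t 0) as [Hs _]; [lra | lra | ].
  unfold sin_approx in Hs; simpl in Hs; unfold sin_term in Hs; simpl in Hs.
  nra.
Qed.

Lemma exp_le_compat (x y : R) : x <= y -> exp x <= exp y.
Proof.
  intros [Hxy | ->]; [apply Rlt_le, exp_increasing, Hxy | apply Rle_refl].
Qed.

(** As [sin t >= t / 3], the integrand of [(1 + y) * sinc_tail y] is at most
    [1 + y exp (- y t / 3)], whose integral is at most [PI / 2 + 3 <= 5].  The weight
    [1 + y] covers small and large [y] at once. *)
Lemma sinc_tail_bound (y : R) : 0 <= y -> Rabs (sinc_tail y) <= 5 / (1 + y).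
Proof.
  intros Hy.
  apply Rle_div_r; [lra | ].
  rewrite Rmult_comm, <- (Rabs_pos_eq (1 + y)), <- Rabs_mult by lra.
  pose proof PI_RGT_0 as HPI0; pose proof PI_4 as HPI.
  set (G := fun t => t - 3 * exp (- (y * t / 3))).
  apply Rle_trans with (minus (G (PI / 2)) (G 0)).
  - apply (norm_RInt_le (V := R_NormedModule)
             (fun t => (1 + y) * quarter_arc y t)
             (fun t => 1 + y * exp (- (y * t / 3))) 0 (PI / 2)).
    + lra.
    + intros t Ht.
      change (Rabs ((1 + y) * quarter_arc y t) <= 1 + y * exp (- (y * t / 3))).
      rewrite Rabs_mult, (Rabs_pos_eq (1 + y)) by lra.
      unfold quarter_arc; rewrite Rabs_mult.
      pose proof (third_le_sin t Ht) as Hsin.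
      assert (Hcos : Rabs (cos (y * cos t)) <= 1).
      { apply Rabs_le, COS_bound. }
      rewrite (Rabs_pos_eq (exp _)) by apply Rlt_le, exp_pos.
      assert (He1 : exp (- (y * sin t)) <= exp (- (y * t / 3))).
      { apply exp_le_compat; nra. }
      assert (He2 : exp (- (y * sin t)) <= 1).
      { rewrite <- exp_0; apply exp_le_compat; nra. }
      pose proof (exp_pos (- (y * sin t))).
      apply Rle_trans with ((1 + y) * exp (- (y * sin t))); [ | nra].
      apply Rmult_le_compat_l; [lra | ].
      rewrite <- (Rmult_1_r (exp _)) at 2.
      apply Rmult_le_compat_l; lra.
    + apply (is_RInt_scal (V := R_NormedModule) (quarter_arc y)).
      apply (RInt_correct (quarter_arc y)), ex_RInt_quarter_arc.
    + apply (is_RInt_derive G); intros t _.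
      * unfold G; auto_derive; [auto | unfold Rdiv; field].
      * apply (ex_derive_continuous (fun t => 1 + y * exp (- (y * t / 3)))).
        auto_derive; auto.
  - unfold G, minus, plus, opp; simpl.
    replace (- (y * 0 / 3)) with 0 by field.
    rewrite exp_0; pose proof (exp_pos (- (y * (PI / 2) / 3))); lra.
Qed.

(** * Integration by parts on a half-line *)

Lemma continuous_sinc_tail_scaled (r x : R) :
  continuous (fun x => sinc_tail (r * x)) x.
Proof.
  apply (continuous_comp (fun x => r * x) sinc_tail).
  - apply (ex_derive_continuous (fun x => r * x)); auto_derive; auto.
  - apply continuous_sinc_tail.
Qed.

Lemma continuous_sinc_kernel_mult (h h' : R -> R)
    (h_derive : forall x, is_derive h x (h' x))
    (r x : R) :
  continuous (fun x => r * sinc (r * x) * h x) x.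
Proof.
  apply (continuous_mult (fun x => r * sinc (r * x)) h).
  - apply (continuous_mult (fun _ => r) (fun x => sinc (r * x))).
    + apply continuous_const.
    + apply (continuous_comp (fun x => r * x) sinc).
      * apply (ex_derive_continuous (fun x => r * x)); auto_derive; auto.
      * apply continuous_sinc.
  - apply (ex_derive_continuous h); eexists; apply h_derive.
Qed.

Lemma ex_RInt_sinc_kernel_mult (h h' : R -> R)
    (h_derive : forall x, is_derive h x (h' x))
    (r a b : R) :
  ex_RInt (fun x => r * sinc (r * x) * h x) a b.
Proof.
  apply (ex_RInt_continuous (fun x => r * sinc (r * x) * h x)).
  intros; now apply (continuous_sinc_kernel_mult h h').
Qed.

(** The function [- sinc_tail (r * x)] is a primitive of [r * sinc (r * x)]; the
    boundary term at [0] produces [PI / 2 * h 0], and the one at [A] vanishes. *)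
Lemma RInt_sinc_kernel_by_parts (h h' : R -> R)
    (h_derive : forall x, is_derive h x (h' x))
    (h'_continuous : forall x, continuous h' x)
    (r A : R) : h A = 0 ->
  RInt (fun x => r * sinc (r * x) * h x) 0 A - PI / 2 * h 0
  = RInt (fun x => sinc_tail (r * x) * h' x) 0 A.
Proof.
  intros HA.
  pose (F := fun x => - (sinc_tail (r * x) * h x)).
  assert (Hint : is_RInt (fun x => r * sinc (r * x) * h x - sinc_tail (r * x) * h' x)
                   0 A (minus (F A) (F 0))).
  { apply (is_RInt_derive F); intros x _.
    - replace (r * sinc (r * x) * h x - sinc_tail (r * x) * h' x)
        with (- (r * - sinc (r * x) * h x + sinc_tail (r * x) * h' x)) by ring.
      apply (is_derive_opp (fun x => sinc_tail (r * x) * h x)).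
      apply (is_derive_mult (fun x => sinc_tail (r * x)) h).
      + apply (is_derive_comp sinc_tail (fun x => r * x)).
        * apply is_derive_sinc_tail.
        * auto_derive; [auto | ring].
      + apply h_derive.
      + intros; apply Rmult_comm.
    - apply (continuous_minus (fun x => r * sinc (r * x) * h x)
               (fun x => sinc_tail (r * x) * h' x)).
      + now apply (continuous_sinc_kernel_mult h h').
      + apply (continuous_mult (fun x => sinc_tail (r * x)) h').
        * apply continuous_sinc_tail_scaled.
        * apply h'_continuous. }
  apply (is_RInt_unique (V := R_CompleteNormedModule)) in Hint.
  rewrite (RInt_minus (fun x => r * sinc (r * x) * h x)
             (fun x => sinc_tail (r * x) * h' x)) in Hint.
  2: now apply (ex_RInt_sinc_kernel_mult h h').
  2: { apply (ex_RInt_continuous (fun x => sinc_tail (r * x) * h' x)).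
       intros x _; apply (continuous_mult (fun x => sinc_tail (r * x)) h').
       - apply continuous_sinc_tail_scaled.
       - apply h'_continuous. }
  unfold F, minus, plus, opp in Hint; simpl in Hint.
  rewrite HA, !Rmult_0_r, sinc_tail_0 in Hint; lra.
Qed.

(** With [M] the maximum of [|h'|] on [[0, A]], the remainder of the integration by
    parts is at most the integral of [5 M / (1 + r x)]. *)
Lemma sinc_kernel_half_line_bound (h h' : R -> R)
    (h_derive : forall x, is_derive h x (h' x))
    (h'_continuous : forall x, continuous h' x)
    (A : R) : 0 <= A -> h A = 0 ->
  exists M, forall r, 0 < r ->
    Rabs (RInt (fun x => r * sinc (r * x) * h x) 0 A - PI / 2 * h 0)
    <= M * (ln (1 + r * A) / r).
Proof.
  intros HA HhA.
  destruct (continuity_ab_maj (fun x => Rabs (h' x)) 0 A HA) as [x0 [Hx0 _]].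
  { intros x _; apply continuity_pt_filterlim.
    apply (continuous_comp h' Rabs); [apply h'_continuous | apply continuous_Rabs]. }
  set (M := Rabs (h' x0)) in Hx0.
  exists (5 * M); intros r Hr.
  rewrite (RInt_sinc_kernel_by_parts h h') by assumption.
  set (G := fun x => 5 * M * (ln (1 + r * x) / r)).
  apply Rle_trans with (minus (G A) (G 0)).
  - apply (norm_RInt_le (V := R_NormedModule)
             (fun x => sinc_tail (r * x) * h' x)
             (fun x => 5 * M / (1 + r * x)) 0 A).
    + exact HA.
    + intros x Hx.
      change (Rabs (sinc_tail (r * x) * h' x) <= 5 * M / (1 + r * x)).
      rewrite Rabs_mult.
      replace (5 * M / (1 + r * x)) with (5 / (1 + r * x) * M) by (field; nra).
      apply Rmult_le_compat; try apply Rabs_pos.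
      * apply sinc_tail_bound; nra.
      * apply Hx0, Hx.
    + apply (RInt_correct (fun x => sinc_tail (r * x) * h' x)).
      apply (ex_RInt_continuous (fun x => sinc_tail (r * x) * h' x)).
      intros x _; apply (continuous_mult (fun x => sinc_tail (r * x)) h').
      * apply continuous_sinc_tail_scaled.
      * apply h'_continuous.
    + apply (is_RInt_derive G); intros x Hx;
        rewrite Rmin_left, Rmax_right in Hx by exact HA.
      * unfold G; auto_derive; [nra | field; split; nra].
      * apply (ex_derive_continuous (fun x => 5 * M / (1 + r * x))).
        auto_derive; nra.
  - unfold G, minus, plus, opp; simpl.
    rewrite Rmult_0_r, Rplus_0_r, ln_1; apply Req_le; field; lra.
Qed.

Lemma is_lim_ln_affine_div (A : R) : 0 < A ->
  is_lim (fun r => ln (1 + r * A) / r) p_infty 0.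
Proof.
  intros HA.
  apply is_lim_ext_loc with
    (fun r => ln (1 + r * A) / (1 + r * A) * (/ r + A)).
  { exists 0; intros r Hr; field; split; nra. }
  replace (Finite 0) with (Finite (0 * (0 + A))) by (f_equal; ring).
  apply (is_lim_mult _ _ p_infty 0 (0 + A)); [ | | exact I].
  - apply (is_lim_comp (fun y => ln y / y) (fun r => 1 + r * A) p_infty 0 p_infty).
    + apply is_lim_div_ln_p.
    + apply is_lim_spec; intros M; exists (M / A); intros r Hr.
      apply (Rlt_div_l M r A HA) in Hr; lra.
    + exists 0; intros; discriminate.
  - apply (is_lim_plus _ _ p_infty 0 A); [ | apply is_lim_const | reflexivity].
    apply (is_lim_inv (fun r => r) p_infty p_infty); [apply is_lim_id | discriminate].
Qed.

(** * The limit for real functions *)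

(** Folding the integral at [0], by evenness of the kernel, reduces to the
    half-line estimate for [f x + f (- x)]. *)
Lemma sinc_kernel_limit (f f' : R -> R) (A : R)
    (f_derive : forall x, is_derive f x (f' x))
    (f'_continuous : forall x, continuous f' x) :
  0 < A -> f A = 0 -> f (- A) = 0 ->
  is_lim (fun r => RInt (fun x => r / PI * sinc (r * x) * f x) (- A) A)
    p_infty (f 0).
Proof.
  intros HA HfA HfA'.
  set (fneg := fun x => f (- x)).
  assert (fneg_derive : forall x, is_derive fneg x (- f' (- x))).
  { intros x; replace (- f' (- x)) with (-1 * f' (- x)) by ring.
    apply (is_derive_comp f (fun x => - x)); [apply f_derive | ].
    auto_derive; [auto | ring]. }
  set (h := fun x => f x + fneg x).
  set (h' := fun x => f' x + - f' (- x)).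
  destruct (sinc_kernel_half_line_bound h h') with (A := A) as [M HM].
  - intros x; apply (is_derive_plus f fneg); auto.
  - intros x; apply (continuous_plus f' (fun x => - f' (- x))); [auto | ].
    apply (continuous_opp (V := R_NormedModule) (fun x => f' (- x))).
    apply (continuous_comp Ropp f'); [ | auto].
    apply (continuous_opp (V := R_NormedModule) (fun x => x)), continuous_id.
  - lra.
  - unfold h, fneg; lra.
  - assert (HRInt : forall r, RInt (fun x => r / PI * sinc (r * x) * f x) (- A) A
              = / PI * RInt (fun x => r * sinc (r * x) * h x) 0 A).
    { intros r.
      pose proof (RInt_correct _ _ _ (ex_RInt_sinc_kernel_mult f f' f_derive r 0 A))
        as H1.
      pose proof (RInt_correct _ _ _
                    (ex_RInt_sinc_kernel_mult fneg _ fneg_derive r 0 A)) as H2.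
      set (I1 := RInt _ 0 A) in H1; set (I2 := RInt _ 0 A) in H2.
      assert (H3 : is_RInt (fun x => r * sinc (r * x) * f x) (- A) 0 I2).
      { rewrite <- (Ropp_involutive I2).
        apply (is_RInt_ext
                 (fun y => opp (opp (r * sinc (r * - y) * fneg (- y))))).
        - intros y _; rewrite opp_opp; unfold fneg.
          rewrite Ropp_involutive, Ropp_mult_distr_r_reverse, sinc_even; reflexivity.
        - apply (is_RInt_opp (V := R_NormedModule)
                   (fun y => opp (r * sinc (r * - y) * fneg (- y)))).
          apply (is_RInt_comp_opp (V := R_NormedModule)
                   (fun y => r * sinc (r * y) * fneg y)).
          rewrite Ropp_involutive, Ropp_0.
          now apply (is_RInt_swap (V := R_NormedModule)). }
      rewrite (is_RInt_unique (V := R_CompleteNormedModule)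
                 (fun x => r * sinc (r * x) * h x) 0 A (I1 + I2)).
      - apply is_RInt_unique.
        apply (is_RInt_ext (fun x => / PI * (r * sinc (r * x) * f x))).
        { intros x _; unfold Rdiv; simpl; ring. }
        apply (is_RInt_scal (V := R_NormedModule)
                 (fun x => r * sinc (r * x) * f x)).
        rewrite Rplus_comm.
        now apply (is_RInt_Chasles (V := R_NormedModule)
                 (fun x => r * sinc (r * x) * f x) (- A) 0 A).
      - apply (is_RInt_ext (fun x => r * sinc (r * x) * f x
                                     + r * sinc (r * x) * fneg x)).
        { intros x _; unfold h; simpl; ring. }
        now apply (is_RInt_plus (V := R_NormedModule)
          (fun x => r * sinc (r * x) * f x) (fun x => r * sinc (r * x) * fneg x)). }
    pose proof PI_RGT_0 as HPI.
    assert (Hh0 : h 0 = 2 * f 0) by (unfold h, fneg; rewrite Ropp_0; ring).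
    set (e := fun r => / PI * (M * (ln (1 + r * A) / r))).
    assert (He : is_lim e p_infty 0).
    { replace (Finite 0) with (Rbar_mult (/ PI) (Rbar_mult M 0))
        by (simpl; f_equal; ring).
      apply is_lim_scal_l, is_lim_scal_l, is_lim_ln_affine_div, HA. }
    apply is_lim_le_le_loc with (fun r => f 0 - e r) (fun r => f 0 + e r).
    + exists 0; intros r Hr.
      specialize (HM r Hr); rewrite HRInt.
      apply Rabs_le_between in HM; rewrite Hh0 in HM.
      set (I := RInt _ 0 A) in *.
      assert (HI : / PI * I - f 0 = / PI * (I - PI / 2 * (2 * f 0))) by (field; lra).
      assert (HP : 0 < / PI) by now apply Rinv_0_lt_compat.
      unfold e; split; nra.
    + replace (Finite (f 0)) with (Finite (f 0 - 0)) by (f_equal; ring).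
      apply is_lim_minus'; [apply is_lim_const | exact He].
    + replace (Finite (f 0)) with (Finite (f 0 + 0)) by (f_equal; ring).
      apply is_lim_plus'; [apply is_lim_const | exact He].
Qed.

(** * The complex kernel and test functions *)

(** The imaginary part integrates an odd function of [k] over
    a symmetric interval. *)
Lemma delta_sinc (r x : R) : delta r x = RtoC (r / PI * sinc (r * x)).
Proof.
  assert (Hcos : is_RInt (fun k => cos (k * x)) (- r) r (2 * r * sinc (r * x))).
  { destruct (Req_dec x 0) as [-> | Hx].
    - apply (is_RInt_ext (fun _ => 1)).
      { intros k _; rewrite Rmult_0_r, cos_0; reflexivity. }
      replace (2 * r * sinc (r * 0)) with (scal (r - - r) 1).
      + apply (is_RInt_const (V := R_NormedModule)).
      + unfold sinc; rewrite Rmult_0_r; destruct (Req_EM_T 0 0); [ | lra].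
        unfold scal; simpl; unfold mult; simpl; ring.
    - replace (2 * r * sinc (r * x))
        with (minus (sin (r * x) / x) (sin (- r * x) / x)).
      + apply (is_RInt_derive (fun k => sin (k * x) / x)); intros k _.
        * auto_derive; [auto | field; exact Hx].
        * apply (ex_derive_continuous (fun k => cos (k * x))); auto_derive; auto.
      + rewrite Ropp_mult_distr_l_reverse, sin_neg, <- (sinc_mult_self (r * x)).
        unfold minus, plus, opp; simpl; field; exact Hx. }
  assert (Hsin : is_RInt (fun k => sin (k * x)) (- r) r 0).
  { destruct (Req_dec x 0) as [-> | Hx].
    - apply (is_RInt_ext (fun _ => 0)).
      { intros k _; rewrite Rmult_0_r, sin_0; reflexivity. }
      pose proof (is_RInt_const (V := R_NormedModule) (- r) r 0) as H.
      exact (eq_ind _ (is_RInt (V := R_NormedModule) (fun _ => 0) (- r) r) H 0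
               (Rmult_0_r (r - - r))).
    - replace 0 with (minus (- cos (r * x) / x) (- cos (- r * x) / x)).
      + apply (is_RInt_derive (fun k => - cos (k * x) / x)); intros k _.
        * auto_derive; [auto | field; exact Hx].
        * apply (ex_derive_continuous (fun k => sin (k * x))); auto_derive; auto.
      + rewrite Ropp_mult_distr_l_reverse, cos_neg.
        unfold minus, plus, opp; simpl; field; exact Hx. }
  pose proof PI_RGT_0 as HPI.
  unfold delta.
  rewrite (is_RInt_unique (V := C_R_CompleteNormedModule) _ _ _
             (2 * r * sinc (r * x), 0)).
  - unfold Cmult, RtoC; simpl; f_equal; field; lra.
  - apply (is_RInt_ext (V := C_R_NormedModule)
             (fun k => (cos (k * x), sin (k * x)))).
    { intros k _; unfold Cexp, Cmult, Ci, RtoC, Re, Im; simpl.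
      replace (0 * (k * x) - 1 * 0) with 0 by ring.
      replace (0 * 0 + 1 * (k * x)) with (k * x) by ring.
      rewrite exp_0; f_equal; ring. }
    apply (is_RInt_fct_extend_pair (U := R_NormedModule) (V := R_NormedModule));
      assumption.
Qed.

Lemma test_function_bounded_support (f : R -> C) : test_function f ->
  exists A, 0 < A /\ forall x, A <= Rabs x -> f x = RtoC 0.
Proof.
  intros [_ Hc].
  destruct (compact_P1 _ Hc) as [m [M HmM]].
  exists (Rabs m + Rabs M + 1).
  pose proof (Rabs_pos m); pose proof (Rabs_pos M).
  split; [lra | intros x Hx].
  destruct (Ceq_dec (f x) (RtoC 0)) as [Hf | Hf]; [exact Hf | exfalso].
  assert (Hmx : m <= x <= M) by now apply HmM, adherence_P1.
  revert Hx; unfold Rabs; repeat destruct Rcase_abs; lra.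
Qed.

(** Two derivatives are used: the second only serves to make the first
    continuous. *)
Lemma test_function_components_C1 (f : R -> C) : test_function f ->
  exists g : R -> C,
    (forall x, is_derive (fun y => Re (f y)) x (Re (g x))) /\
    (forall x, is_derive (fun y => Im (f y)) x (Im (g x))) /\
    (forall x, continuous (fun y => Re (g y)) x) /\
    (forall x, continuous (fun y => Im (g y)) x).
Proof.
  intros [Hsmooth _].
  destruct (Hsmooth 2%nat) as [g [Hg [g2 [Hg2 _]]]].
  assert (Hfst : forall (u v : R -> C) x,
            is_derive (V := C_R_NormedModule) u x (v x) ->
            is_derive (fun y => Re (u y)) x (Re (v x))).
  { intros u v x Hu.
    apply (filterdiff_comp (U := R_NormedModule) (V := C_R_NormedModule)
      (W := R_NormedModule) u Re _ Re Hu).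
    apply (filterdiff_linear (U := C_R_NormedModule) (V := R_NormedModule)).
    apply (is_linear_fst (U := R_NormedModule) (V := R_NormedModule)). }
  assert (Hsnd : forall (u v : R -> C) x,
            is_derive (V := C_R_NormedModule) u x (v x) ->
            is_derive (fun y => Im (u y)) x (Im (v x))).
  { intros u v x Hu.
    apply (filterdiff_comp (U := R_NormedModule) (V := C_R_NormedModule)
      (W := R_NormedModule) u Im _ Im Hu).
    apply (filterdiff_linear (U := C_R_NormedModule) (V := R_NormedModule)).
    apply (is_linear_snd (U := R_NormedModule) (V := R_NormedModule)). }
  exists g; split; [ | split; [ | split]]; intros x; auto.
  - apply (ex_derive_continuous (fun y => Re (g y))); eexists; apply Hfst, Hg2.
  - apply (ex_derive_continuous (fun y => Im (g y))); eexists; apply Hsnd, Hg2.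
Qed.

(** Once the endpoints have passed [- A] and [A], the integral no longer depends on
    them, so that the improper integral is attained. *)
Lemma delta_pairing_components (f : R -> C) (A r : R) : 0 < A ->
  (forall x, A <= Rabs x -> f x = RtoC 0) ->
  (forall x, ex_derive (fun y => Re (f y)) x) ->
  (forall x, ex_derive (fun y => Im (f y)) x) ->
  delta_pairing r f
  = (RInt (fun x => r / PI * sinc (r * x) * Re (f x)) (- A) A,
     RInt (fun x => r / PI * sinc (r * x) * Im (f x)) (- A) A).
Proof.
  intros HA Hzero HRe HIm.
  set (l := (_, _)).
  assert (Hmid : is_RInt (V := C_R_NormedModule)
                   (fun x => Cmult (delta r x) (f x)) (- A) A l).
  { assert (Hint : forall u : R -> R, (forall x, ex_derive u x) ->
              is_RInt (fun x => r / PI * sinc (r * x) * u x) (- A) A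
                (RInt (fun x => r / PI * sinc (r * x) * u x) (- A) A)).
    { intros u Hu; apply (RInt_correct (fun x => r / PI * sinc (r * x) * u x)).
      apply (ex_RInt_ext (fun x => / PI * (r * sinc (r * x) * u x))).
      { intros x _; unfold Rdiv; simpl; ring. }
      apply (ex_RInt_scal (V := R_NormedModule) (fun x => r * sinc (r * x) * u x)).
      apply (ex_RInt_sinc_kernel_mult u (Derive u)).
      intros x; apply Derive_correct, Hu. }
    apply (is_RInt_ext (V := C_R_NormedModule)
             (fun x => (r / PI * sinc (r * x) * Re (f x),
                        r / PI * sinc (r * x) * Im (f x)))).
    { intros x _; rewrite delta_sinc; unfold Cmult, RtoC, Re, Im; simpl.
      f_equal; ring. }
    apply (is_RInt_fct_extend_pair (U := R_NormedModule) (V := R_NormedModule));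
      apply Hint; assumption. }
  assert (Hout : forall a b : R, (forall x, Rmin a b < x < Rmax a b -> A <= Rabs x) ->
            is_RInt (V := C_R_NormedModule)
              (fun x => Cmult (delta r x) (f x)) a b zero).
  { intros a b Hab.
    apply (is_RInt_ext (V := C_R_NormedModule) (fun _ => zero)).
    - intros x Hx; rewrite (Hzero x (Hab x Hx)).
      symmetry; apply Cmult_0_r.
    - exact (eq_ind _ (is_RInt (V := C_R_NormedModule) (fun _ => zero) a b)
               (is_RInt_const (V := C_R_NormedModule) a b zero) zero
               (scal_zero_r (V := C_R_NormedModule) (b - a))). }
  apply (is_RInt_gen_unique (V := C_R_CompleteNormedModule)
           (fun x => Cmult (delta r x) (f x)) l).
  intros P HP.
  exists (fun a => a < - A) (fun b => A < b).
  - exists (- A); auto.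
  - exists A; auto.
  - intros a b Ha Hb; exists l; split; [ | now apply locally_singleton].
    simpl.
    replace l with (plus zero (plus l zero) : C_R_NormedModule)
      by (rewrite plus_zero_l, plus_zero_r; reflexivity).
    apply (is_RInt_Chasles (V := C_R_NormedModule) _ a (- A) b).
    + apply Hout; intros x Hx.
      rewrite Rmin_left, Rmax_right in Hx by lra.
      rewrite Rabs_left; lra.
    + apply (is_RInt_Chasles (V := C_R_NormedModule) _ (- A) A b); [exact Hmid | ].
      apply Hout; intros x Hx.
      rewrite Rmin_left, Rmax_right in Hx by lra.
      rewrite Rabs_pos_eq; lra.
Qed.

Theorem mainTheorem1 :
  (forall r : R, 0 < r ->
     (forall x : R, x <> 0 -> delta r x = RtoC (sin (r * x) / (PI * x))) /\
     delta r 0 = RtoC (r / PI)) /\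
  (forall f : R -> C, test_function f ->
     filterlim (fun r : R => delta_pairing r f)
       (Rbar_locally p_infty) (locally (f 0))).
Proof.
  pose proof PI_RGT_0 as HPI.
  split.
  - intros r Hr; split.
    + intros x Hx; rewrite delta_sinc, <- sinc_mult_self.
      f_equal; field; lra.
    + rewrite delta_sinc, Rmult_0_r.
      unfold sinc; destruct (Req_EM_T 0 0); [f_equal; ring | lra].
  - intros f Hf.
    destruct (test_function_bounded_support f Hf) as [A [HA Hzero]].
    destruct (test_function_components_C1 f Hf) as [g [HRe [HIm [HcRe HcIm]]]].
    apply (filterlim_ext (fun r =>
      (RInt (fun x => r / PI * sinc (r * x) * Re (f x)) (- A) A,
       RInt (fun x => r / PI * sinc (r * x) * Im (f x)) (- A) A) : C)).
    { intros r; symmetry; apply delta_pairing_components; auto.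
      - intros x; eexists; apply HRe.
      - intros x; eexists; apply HIm. }
    assert (HfA : f A = RtoC 0) by (apply Hzero; rewrite Rabs_pos_eq; lra).
    assert (HfA' : f (- A) = RtoC 0) by (apply Hzero; rewrite Rabs_left; lra).
    apply filterlim_locally; intros eps.
    pose proof (proj1 (filterlim_locally _ _)
      (sinc_kernel_limit (fun x => Re (f x)) (fun x => Re (g x)) A HRe HcRe HA
        (f_equal Re HfA) (f_equal Re HfA')) eps) as H1.
    pose proof (proj1 (filterlim_locally _ _)
      (sinc_kernel_limit (fun x => Im (f x)) (fun x => Im (g x)) A HIm HcIm HA
        (f_equal Im HfA) (f_equal Im HfA')) eps) as H2.
    generalize (filter_and _ _ H1 H2); apply filter_imp.
    intros r [B1 B2]; split; assumption.
Qed.
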